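(* Let $G$ be a finite abelian group, let $V$ be a free $G$-representation over $\mathbb C$ of rank $d$ (that is, $V\cong\mathbb C[G]^d$), and let $n\in\mathbb N$. Then the rule $$\Phi(X)=X\otimes_{G\wr S_n}V^{\otimes n},\qquad\Phi(0)=0,$$ where $\mathrm{Aut}_G(V)$ acts through the diagonal action on $V^{\otimes n}$, induces a well-defined map $$\Phi\colon\left\{\begin{array}{c}\text{irreducible }G\wr S_n\text{-representations}\\ \text{over }\mathbb C\text{ up to isomorphism}\end{array}\right\}\cup\{0\}\longrightarrow\left\{\begin{array}{c}\text{irreducible polynomial }\mathrm{Aut}_G(V)\text{-representations over }\mathbb C\\ \text{of homogeneous degree }n\text{ up to isomorphism}\end{array}\right\}\cup\{0\}.$$ The map $\Phi$ is always surjective, and it is always injective outside of its kernel (i.e. if $X,Y$ are non-isomorphic irreducible $G\wr S_n$-representations with $\Phi(X)\ne0\ne\Phi(Y)$, then $\Phi(X)\not\cong\Phi(Y)$). If $n\le d$, then $\Phi$ is a bijection.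
   Context: $G\wr S_n=G^n\rtimes S_n$ acts on $V^{\otimes n}$ with $G^n$ acting factorwise and $S_n$ permuting the tensor factors; this commutes with the diagonal action of $\mathrm{Aut}_G(V)$. For representations $E,F$ of a finite group $H$, $E\otimes_HF$ denotes the $H$-coinvariants of $E\otimes_{\mathbb C}F$ with diagonal $H$-action. (Thus $\Phi(X)=\Xi(X)(V)$ for the functor $\Xi(X)=X\otimes_{G\wr S_n}T^n(-)$, with $T^n$ the $n$-th tensor power.) $\mathrm{Aut}_G(V)$ denotes the group of $G$-equivariant linear automorphisms of $V$, viewed as a matrix group in $\mathrm{GL}(V)$ with respect to the standard basis of $\mathbb C[G]^d$. A finite-dimensional representation $\rho$ of $\mathrm{Aut}_G(V)$ is polynomial if its matrix coefficients (in one, equivalently any, basis) are restrictions to $\mathrm{Aut}_G(V)$ of polynomials in the matrix entries; it is polynomial of homogeneous degree $n$ if they are restrictions of homogeneous polynomials of degree $n$ in the matrix entries. *)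

(* Defs.v *)
From HB Require Import structures.
From mathcomp Require Import all_boot all_order all_algebra.
From mathcomp Require Import all_fingroup all_solvable all_field all_character.
From mathcomp.multinomials Require Import mpoly.
From mathcomp Require Import mxtens.
From mathcomp Require Import boolp classical_sets functions.

Set Implicit Arguments.
Unset Strict Implicit.
Unset Printing Implicit Defensive.

Import GRing.Theory.
Local Open Scope ring_scope.

(* Conventions: as everywhere in MathComp, matrices act on row vectors, groups *)
(* act on the right, and (s * t)%g i = t (s i) for permutations s and t.       *)

Section Wreath.
Variables (gT : finGroupType) (n : nat).

Definition gpow : finGroupType := {dffun forall _ : 'I_n, gT}.

(* The i-th component of x becomes the (s i)-th component of permg x s. *)
Definition permg (x : gpow) (s : 'S_n) : gpow := [ffun i => x (s^-1%g i)].

Lemma permg_is_action : is_action [set: 'S_n] permg.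
Proof.
apply: is_total_action => [x | x s t]; apply/ffunP => i.
  by rewrite ffunE invg1 perm1.
by rewrite !ffunE invMg permM.
Qed.
Canonical permg_action := Action permg_is_action.

Lemma permg_is_groupAction : is_groupAction [set: gpow] permg_action.
Proof.
move=> s _; rewrite inE; apply/andP; split.
  by apply/fintype.subsetP => x; rewrite inE.
apply/morphicP => x y _ _; rewrite !actpermE /=; apply/ffunP => i.
by rewrite !ffunE.
Qed.
Canonical permg_groupAction := GroupAction permg_is_groupAction.

(* An element u consists of u.1 : 'S_n and u.2 : gpow, and stands for the *)
(* product of u.1 and u.2 in this order.                                  *)
Definition wreath : finGroupType := sdprod_by permg_groupAction.

End Wreath.

Section TensorPower.
Variables (F : fieldType) (N n : nat).

(* The n-th tensor power of 'rV[F]_N has the basis indexed by the functions *)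
(* 'I_n -> 'I_N, numbered by tfun.                                          *)
Definition tdeg : nat := #|{: {ffun 'I_n -> 'I_N}}|.
Definition tfun (a : 'I_tdeg) : {ffun 'I_n -> 'I_N} := enum_val a.
Definition tindex (f : {ffun 'I_n -> 'I_N}) : 'I_tdeg := enum_rank f.

Lemma tfunK : cancel tfun tindex. Proof. exact: enum_valK. Qed.
Lemma tindexK : cancel tindex tfun. Proof. exact: enum_rankK. Qed.
Lemma tfun_inj : injective tfun. Proof. exact: can_inj tfunK. Qed.
Lemma tfun_bij : bijective tfun. Proof. exact: Bijective tfunK tindexK. Qed.

Definition tensv (v : 'I_n -> 'rV[F]_N) : 'rV[F]_tdeg :=
  \row_a \prod_i v i 0 (tfun a i).

Definition tensop (A : 'I_n -> 'M[F]_N) : 'M[F]_tdeg :=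
  \matrix_(a, b) \prod_i A i (tfun a i) (tfun b i).

Definition permop (s : 'S_n) : 'M[F]_tdeg :=
  \matrix_(a, b) ([ffun i => tfun a (s^-1%g i)] == tfun b)%:R.

Lemma sum_tdeg (f : {ffun 'I_n -> 'I_N} -> F) :
  \sum_(a < tdeg) f (tfun a) = \sum_x f x.
Proof. by rewrite [RHS](reindex _ (onW_bij _ tfun_bij)). Qed.

Lemma tensv_tensop v A : tensv v *m tensop A = tensv (fun i => v i *m A i).
Proof.
apply/rowP => b; rewrite !mxE.
under [RHS]eq_bigr do rewrite mxE.
rewrite bigA_distr_bigA /= -sum_tdeg; apply: eq_bigr => c _.
by rewrite !mxE -big_split.
Qed.

Lemma tensv_permop v s : tensv v *m permop s = tensv (v \o s^-1%g).
Proof.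
apply/rowP => b; rewrite !mxE.
pose h (x : {ffun 'I_n -> 'I_N}) : F := \prod_i v i 0 (x i)
   * ([ffun i => x (s^-1%g i)] == tfun b)%:R.
rewrite (eq_bigr (fun a => h (tfun a))) => [|a _]; last by rewrite !mxE.
pose x0 := [ffun i => tfun b (s i)].
have x0E i : x0 (s^-1%g i) = tfun b i by rewrite ffunE permKV.
rewrite sum_tdeg (bigD1 x0) //= big1 => [|x neq_x].
  rewrite addr0 /h (_ : [ffun i => _] = tfun b); last first.
    by apply/ffunP => i; rewrite ffunE x0E.
  rewrite eqxx mulr1 (reindex_inj (@perm_inj _ s^-1%g)) /=.
  by apply: eq_bigr => i _; rewrite x0E.
rewrite /h; case: eqP => [eq_b|_]; last by rewrite mulr0.
by case/eqP: neq_x; apply/ffunP => i; rewrite ffunE -eq_b ffunE permK.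
Qed.

Lemma tensopM A B : tensop A *m tensop B = tensop (fun i => A i *m B i).
Proof.
apply/matrixP => a b; rewrite !mxE.
under [RHS]eq_bigr do rewrite mxE.
rewrite bigA_distr_bigA /= -sum_tdeg; apply: eq_bigr => c _.
by rewrite !mxE -big_split.
Qed.

Lemma tensop_eq A B : A =1 B -> tensop A = tensop B.
Proof.
by move=> eqAB; apply/matrixP => a b; rewrite !mxE; apply: eq_bigr => i _;
   rewrite eqAB.
Qed.

Lemma tensop1 : tensop (fun=> 1%:M) = 1%:M.
Proof.
apply/matrixP => a b; rewrite !mxE.
case: eqP => [-> | neq_ab]; first by rewrite big1 // => i _; rewrite mxE eqxx.
have [i neq_i] : exists i, tfun a i != tfun b i.
  apply/existsP; apply: contra_notT neq_ab; rewrite negb_exists => /forallP eq_ab.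
  by apply: tfun_inj; apply/ffunP => i; apply/eqP; rewrite -[_ == _]negbK.
by rewrite (bigD1 i) //= mxE (negPf neq_i) mul0r.
Qed.

Lemma row_permop a s :
  row a (permop s) = delta_mx 0 (tindex [ffun i => tfun a (s^-1%g i)]).
Proof.
apply/rowP => b; rewrite !mxE eqxx /= -(inj_eq tfun_inj) tindexK.
by rewrite eq_sym.
Qed.

Lemma permop1 : permop 1%g = 1%:M.
Proof.
apply/row_matrixP => a; rewrite row_permop row1; congr delta_mx.
apply: tfun_inj; rewrite tindexK; apply/ffunP => i.
by rewrite ffunE invg1 perm1.
Qed.

Lemma permopM s t : permop s *m permop t = permop (s * t)%g.
Proof.
apply/row_matrixP => a; rewrite row_mul !row_permop -rowE row_permop.
congr delta_mx; congr tindex; apply/ffunP => i.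
by rewrite tindexK !ffunE invMg permM.
Qed.

Lemma tensop_permop A s :
  tensop A *m permop s = permop s *m tensop (A \o s^-1%g).
Proof.
apply/row_matrixP => a; rewrite !row_mul row_permop -rowE.
have -> : row a (tensop A) = tensv (fun i => row (tfun a i) (A i)).
  by apply/rowP => b; rewrite !mxE; apply: eq_bigr => i _; rewrite mxE.
rewrite tensv_permop; apply/rowP => b; rewrite !mxE tindexK.
by apply: eq_bigr => i _; rewrite !mxE ffunE.
Qed.

End TensorPower.

Section WreathTensorPower.
Variables (F : fieldType) (gT : finGroupType) (N n : nat).
Variable V : mx_representation F [set: gT] N.

Definition wreath_tens_mx (u : wreath gT n) : 'M[F]_(tdeg N n) :=
  permop F N u.1 *m tensop (fun i => V (u.2 i)).

Lemma wreath_tens_mx_repr : mx_repr [set: wreath gT n] wreath_tens_mx.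
Proof.
split=> [|u v _ _]; rewrite /wreath_tens_mx /=.
  rewrite permop1 mul1mx (@tensop_eq _ _ _ _ (fun=> 1%:M)) ?tensop1 // => i.
  by rewrite ffunE repr_mx1.
rewrite -mulmxA [tensop _ *m (_ *m _)]mulmxA tensop_permop -!mulmxA tensopM.
rewrite mulmxA permopM; congr (_ *m _); apply: tensop_eq => i.
by rewrite !ffunE repr_mxM ?inE.
Qed.

Definition wreath_tens : representation F [set: wreath gT n] :=
  Representation (MxRepresentation wreath_tens_mx_repr).

(* The group of G-equivariant automorphisms of V, as a set of matrices. *)
Definition aut_rep : pred 'M[F]_N :=
  [pred A | (A \in unitmx) && centgmx V A].

Lemma wreath_tens_aut A u : A \in aut_rep ->
  wreath_tens_mx u *m tensop (fun=> A) = tensop (fun=> A) *m wreath_tens_mx u.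
Proof.
case/andP=> _ /centgmxP cVA; rewrite /wreath_tens_mx mulmxA tensop_permop.
rewrite -!mulmxA !tensopM; congr (_ *m _); apply: tensop_eq => i /=.
by rewrite cVA ?inE.
Qed.

End WreathTensorPower.

Section MatrixGroupRepresentations.
Variables (F : fieldType) (N : nat) (S : pred 'M[F]_N).

(* A finite-dimensional representation of the matrix group S; the values of *)
(* mgfun outside S are irrelevant.                                          *)
Record mgrep := MGRep {
  mgdeg : nat;
  mgfun :> 'M[F]_N -> 'M[F]_mgdeg;
  mgfun1 : mgfun 1%:M = 1%:M;
  mgfunM : {in S &, {morph mgfun : A B / A *m B}}
}.

Variant mg_rsim (W1 W2 : mgrep) : Prop :=
  MGRsim B of mgdeg W1 = mgdeg W2 & row_free B
            & (forall A, A \in S -> W1 A *m B = B *m W2 A).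

Definition mg_irreducible (W : mgrep) : Prop :=
  (0 < mgdeg W)%N /\
  forall U : 'M[F]_(mgdeg W),
    (forall A, A \in S -> stablemx U (W A)) -> U != 0 -> row_full U.

(* The N * N variables stand for the entries of a matrix, listed by mxvec. *)
Definition mg_homog_poly (n : nat) (W : mgrep) : Prop :=
  forall i j : 'I_(mgdeg W),
    exists2 p : {mpoly F[N * N]}, p \is n.-homog
      & forall A, A \in S -> W A i j = p.@[fun k => mxvec A 0 k].

Lemma mgrep0_1 : (0 : 'M[F]_0) = 1%:M.
Proof. by rewrite [RHS]flatmx0. Qed.

Lemma mgrep0_M : {in S &, {morph (fun=> 0 : 'M[F]_0) : A B / A *m B}}.
Proof. by move=> A B _ _; rewrite mul0mx. Qed.

Definition mgrep0 : mgrep := MGRep mgrep0_1 mgrep0_M.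

Definition mg_class (W : mgrep) : set mgrep := [set W' | mg_rsim W W']%classic.

End MatrixGroupRepresentations.

Arguments mgrep0 {F N} S.

Section Coinvariants.
Variables (F : fieldType) (hT : finGroupType) (H : {group hT}).
Variables E E' : representation F H.

(* The row space is the subspace of the tensor product of E and E' spanned by *)
(* all w h - w with h in H, for the diagonal action of H. The coinvariants    *)
(* are the quotient by this subspace, in the coordinates of in_factmod, whose *)
(* kernel is coinv_rel by in_factmod_eq0.                                     *)
Definition coinv_rel : 'M[F]_(rdegree E * rdegree E') :=
  (\sum_(h in H) ((E h *t E' h) - 1%:M))%MS.

Definition coinv_deg : nat := \rank (cokermx coinv_rel).

(* The endomorphism of the coinvariants induced by the operator 1 (x) A. *)
Definition coinv_op (A : 'M[F]_(rdegree E')) : 'M[F]_coinv_deg :=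
  in_factmod coinv_rel (val_factmod 1%:M *m (1%:M *t A)).

Lemma coinv_op1 : coinv_op 1%:M = 1%:M.
Proof.
rewrite /coinv_op.
have -> : (1%:M : 'M[F]_(rdegree E)) *t (1%:M : 'M[F]_(rdegree E')) = 1%:M.
  apply/matrixP => i j.
  case: (mxtens_indexP i) => i1 i2; case: (mxtens_indexP j) => j1 j2.
  rewrite tensmxE !mxE -natrM mulnb.
  by rewrite (inj_eq (can_inj (@mxtens_indexK _ _))) xpair_eqE.
by rewrite mulmx1 val_factmodK.
Qed.

Lemma coinv_rel_stable A : (forall h, h \in H -> E' h *m A = A *m E' h) ->
  stablemx coinv_rel (1%:M *t A).
Proof.
move=> cEA; rewrite sumsmxMr; apply/sumsmx_subP => h Hh.
apply: (sumsmx_sup h) => //; rewrite mulmxBl mul1mx tensmx_mul mulmx1 cEA //.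
have -> : E h *t (A *m E' h) = (1%:M *t A) *m (E h *t E' h).
  by rewrite tensmx_mul mul1mx.
by rewrite -[X in _ - X]mulmx1 -mulmxBr submxMl.
Qed.

Lemma coinv_opM A B : (forall h, h \in H -> E' h *m B = B *m E' h) ->
  coinv_op (A *m B) = coinv_op A *m coinv_op B.
Proof.
move=> cEB; rewrite /coinv_op; set U := coinv_rel.
have -> : 1%:M *t (A *m B) = (1%:M *t A) *m (1%:M *t B) :> 'M[F]_(rdegree E * _).
  by rewrite tensmx_mul mulmx1.
set TA := 1%:M *t A; set TB := 1%:M *t B; set W := val_factmod 1%:M *m TA.
have -> : in_factmod U W *m in_factmod U (val_factmod 1%:M *m TB)
        = in_factmod U (val_factmod (in_factmod U W) *m TB).
  by rewrite [val_factmod (in_factmod U W)]val_factmodE /in_factmod /= !mulmxA.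
apply/eqP; rewrite mulmxA -/W -subr_eq0 -linearB in_factmod_eq0 -mulmxBl.
rewrite -{1}[W](add_sub_fact_mod U) addrK.
apply: submx_trans (coinv_rel_stable cEB).
by rewrite submxMr // val_submodP.
Qed.

End Coinvariants.

Section Phi.
Variables (F : fieldType) (gT : finGroupType) (N n : nat).
Variable V : mx_representation F [set: gT] N.
Variable X : representation F [set: wreath gT n].

Definition phi_fun (A : 'M[F]_N) : 'M[F]_(coinv_deg X (wreath_tens n V)) :=
  coinv_op X (E' := wreath_tens n V) (tensop (fun=> A)).

Lemma phi_fun1 : phi_fun 1%:M = 1%:M.
Proof. by rewrite /phi_fun tensop1 coinv_op1. Qed.

Lemma phi_funM : {in aut_rep V &, {morph phi_fun : A B / A *m B}}.
Proof.
move=> A B _ autB; rewrite /phi_fun -tensopM coinv_opM // => u _ /=.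
exact: wreath_tens_aut.
Qed.

Definition phi : mgrep (aut_rep V) := MGRep phi_fun1 phi_funM.

End Phi.

Local Open Scope classical_set_scope.

Definition iso_class (F : fieldType) (hT : finGroupType) (H : {group hT})
    (X : representation F H) : set (representation F H) :=
  [set Y : representation F H | mx_rsim X Y].

Definition irr_classes (F : fieldType) (hT : finGroupType) (H : {group hT}) :
    set (set (representation F H)) :=
  [set iso_class X | X in [set X : representation F H | mx_irreducible X]].

Definition mg_irr_homog_classes (F : fieldType) (N : nat) (S : pred 'M[F]_N)
    (n : nat) : set (set (mgrep S)) :=
  [set mg_class W
    | W in [set W : mgrep S | mg_irreducible W /\ mg_homog_poly n W]].

Arguments irr_classes F {hT} H%_G.
Arguments mg_irr_homog_classes {F N} S n.

(* Main.v *)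
From HB Require Import structures.
Require Import Defs.
From mathcomp Require Import all_boot all_order all_algebra.
From mathcomp Require Import all_fingroup all_solvable all_field all_character.
From mathcomp.multinomials Require Import mpoly.
From mathcomp Require Import mxtens.
From mathcomp Require Import boolp.

(* Over a field of characteristic 0, the coinvariants of the tensor product of *)
(* X and T = V^(x)n are identified with Hom_H(X^*, T), where H is the wreath   *)
(* product (coinv_hom). Schur-Weyl duality (schur_weyl) says that the linear   *)
(* span of the tensor powers of elements of Aut_G(V) is End_H(T); it follows   *)
(* from averaging over H, polarization, and the density of Aut_G(V) in         *)
(* End_G(V). Since an irreducible submodule of T is a direct summand, End_H(T) *)
(* acts transitively on the nonzero vectors of Hom_H(X^*, T), which is         *)
(* therefore irreducible, and the projections onto copies of X^* in T tell     *)
(* apart nonisomorphic X. A homogeneous polynomial representation of degree n  *)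
(* extends linearly to a representation of End_H(T); in it some endomorphism   *)
(* of T that factors through an irreducible Y does not vanish, and this yields *)
(* a nonzero map from Hom_H(Y, T) to it, which is an isomorphism. For n <= d   *)
(* the module T contains a free H-orbit of linearly independent vectors, so    *)
(* that every irreducible occurs.                                              *)

Set Implicit Arguments.
Unset Strict Implicit.
Unset Printing Implicit Defensive.

Import Order.TTheory GRing.Theory Num.Theory.
Local Open Scope ring_scope.

(** This is a double centralizer argument. Writing Phi(X) as the intertwiners from the dual of X to
    T turns the action of Aut_G(V) into postcomposition ([coinv_hom_op]). [schur_weyl] has the form
    of an extension principle: a linear identity that holds on tensor powers of elements of Aut_G(V)
    holds on all of End_H(T). Thus stability, intertwining and multiplicativity, checked on the
    group, pass to End_H(T), where the retractions of [hom_mx_retract] supply enough operators for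
    irreducibility ([phi_irreducible]) and for separating classes ([phi_rsim_inj]). Being
    homogeneous of degree n means precisely factoring linearly through the n-th tensor power
    ([mg_homog_polyP]), which makes [phi_surj] a statement about End_H(T) as well. For n <= d, a
    vector with free orbit and a functional dual to it rule out a zero value ([phi_neq0]). *)

(** * Averaging, Schur's lemma, duals and Maschke's theorem *)

Section Intertwiners.
Variables (F : fieldType) (hT : finGroupType) (H : {group hT}).

Definition hom_mx n1 (rG1 : mx_representation F H n1)
    n2 (rG2 : mx_representation F H n2) (M : 'M[F]_(n1, n2)) :=
  forall h, h \in H -> rG1 h *m M = M *m rG2 h.

(** The Reynolds operator: for invertible |H| it is a projection onto the intertwiners. *)
Definition hom_avg n1 (rG1 : mx_representation F H n1)
    n2 (rG2 : mx_representation F H n2) (M : 'M[F]_(n1, n2)) :=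
  #|H|%:R^-1 *: \sum_(h in H) rG1 h^-1%g *m M *m rG2 h.

Section Pair.
Variables (n1 n2 : nat) (rG1 : mx_representation F H n1).
Variable rG2 : mx_representation F H n2.

Lemma hom_avgP M : hom_mx rG1 rG2 (hom_avg rG1 rG2 M).
Proof.
move=> x Hx; rewrite /hom_avg -scalemxAl -scalemxAr; congr (_ *: _).
rewrite [in LHS](reindex_acts 'R _ Hx) ?astabsR //= mulmx_suml mulmx_sumr.
apply: eq_bigr => y Hy; rewrite invMg !repr_mxM ?groupM ?groupV //.
by rewrite !mulmxA -repr_mxM ?groupV // mulgV repr_mx1 mul1mx.
Qed.

Lemma hom_avg_id M :
  #|H|%:R != 0 :> F -> hom_mx rG1 rG2 M -> hom_avg rG1 rG2 M = M.
Proof.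
move=> nzH homM; rewrite /hom_avg (eq_bigr (fun=> M)) => [|h Hh].
  by rewrite sumr_const -scaler_nat scalerA mulVf ?scale1r.
by rewrite homM ?groupV // -mulmxA -repr_mxM ?groupV // mulVg repr_mx1 mulmx1.
Qed.

Lemma hom_avg_is_linear : linear (hom_avg rG1 rG2).
Proof.
move=> a M M'; rewrite /hom_avg scalerA mulrC -scalerA -scalerDr; congr (_ *: _).
rewrite scaler_sumr -big_split; apply: eq_bigr => h _ /=.
by rewrite mulmxDr mulmxDl -scalemxAr -scalemxAl.
Qed.
HB.instance Definition _ := GRing.isLinear.Build F 'M[F]_(n1, n2) 'M[F]_(n1, n2)
  _ (hom_avg rG1 rG2) hom_avg_is_linear.

(** One half of Schur's lemma: the kernel of M is a submodule of a simple module. *)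
Lemma hom_mx_row_free M :
  mx_irreducible rG1 -> hom_mx rG1 rG2 M -> M != 0 -> row_free M.
Proof.
case/mx_irrP=> _ simG homM nzM; rewrite -kermx_eq0; apply: contraR nzM => nzK.
have /simG/(_ nzK): mxmodule rG1 (kermx M).
  apply/mxmoduleP=> h Hh; apply/sub_kermxP.
  by rewrite -mulmxA homM // mulmxA mulmx_ker mul0mx.
rewrite -sub1mx => /sub_kermxP; rewrite mul1mx => ->; exact: eqxx.
Qed.

Lemma hom_mx_row_full M :
  mx_irreducible rG2 -> hom_mx rG1 rG2 M -> M != 0 -> row_full M.
Proof.
case/mx_irrP=> _ simG homM nzM; suff: row_full <<M>>%MS by rewrite -!sub1mx genmxE.
apply: simG.
  apply/mxmoduleP=> h Hh; rewrite (eqmxMr _ (genmxE _)) genmxE -homM //.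
  exact: submxMl.
by rewrite -mxrank_eq0 genmxE mxrank_eq0.
Qed.

Lemma hom_mx_rsim M :
    mx_irreducible rG1 -> mx_irreducible rG2 -> hom_mx rG1 rG2 M -> M != 0 ->
  mx_rsim rG1 rG2.
Proof.
move=> irr1 irr2 homM nzM; have freeM := hom_mx_row_free irr1 homM nzM.
have /eqP fullM := hom_mx_row_full irr2 homM nzM.
by exists M => //; rewrite -fullM; apply/esym/eqP.
Qed.

End Pair.

Lemma hom_mxM n1 n2 n3 (rG1 : mx_representation F H n1)
    (rG2 : mx_representation F H n2) (rG3 : mx_representation F H n3) M N :
  hom_mx rG1 rG2 M -> hom_mx rG2 rG3 N -> hom_mx rG1 rG3 (M *m N).
Proof. by move=> homM homN h Hh; rewrite mulmxA homM // -!mulmxA homN. Qed.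

(** Average a linear one-sided inverse of M: since M is equivariant, each term of the average still
    composes with M to the identity. *)
Lemma hom_mx_retract n1 n2 (rG1 : mx_representation F H n1)
    (rG2 : mx_representation F H n2) M :
    #|H|%:R != 0 :> F -> mx_irreducible rG1 -> hom_mx rG1 rG2 M -> M != 0 ->
  exists2 N, hom_mx rG2 rG1 N & M *m N = 1%:M.
Proof.
move=> nzH irr1 homM nzM; have freeM := hom_mx_row_free irr1 homM nzM.
have:= mulmxVp freeM; move: (pinvmx M) => N MN.
exists (hom_avg rG2 rG1 N); first exact: hom_avgP.
rewrite /hom_avg -scalemxAr mulmx_sumr (eq_bigr (fun=> 1%:M)) => [|h Hh].
  by rewrite sumr_const -scaler_nat scalerA mulVf ?scale1r.
rewrite !mulmxA -homM ?groupV // -(mulmxA _ M) MN mulmx1.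
by rewrite -repr_mxM ?groupV // mulVg repr_mx1.
Qed.

Section Dual.
Variables (n : nat) (rG : mx_representation F H n).

Lemma dual_mx_repr : mx_repr H (fun h => (rG h^-1%g)^T).
Proof.
split=> [|x y Hx Hy]; first by rewrite invg1 repr_mx1 trmx1.
by rewrite invMg repr_mxM ?groupV // trmx_mul.
Qed.
Definition dual_repr := MxRepresentation dual_mx_repr.

(* The annihilator of a submodule of the dual is a submodule. *)
Lemma dual_irreducible : mx_irreducible rG -> mx_irreducible dual_repr.
Proof.
case/mx_irrP=> n_gt0 simG; apply/mx_irrP; split=> // U modU nzU.
have modK: mxmodule rG (kermx U^T).
  apply/mxmoduleP=> h Hh; apply/sub_kermxP; apply: trmx_inj.
  have: U *m (kermx U^T)^T = 0.
    by apply: trmx_inj; rewrite trmx0 trmx_mul trmxK mulmx_ker.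
  move: (kermx _) => K UK; rewrite trmx0 !trmx_mul trmxK.
  have /submxP[C UE] := mxmoduleP modU _ (groupVr Hh).
  rewrite /= invgK in UE; by rewrite mulmxA UE -mulmxA UK mulmx0.
have [K0|nzK] := eqVneq (kermx U^T) 0.
  by rewrite /row_full -mxrank_tr -/(row_free _) -kermx_eq0 K0.
have:= simG _ modK nzK; rewrite -sub1mx => /sub_kermxP; rewrite mul1mx.
by move/eqP; rewrite trmx_eq0 (negPf nzU).
Qed.

End Dual.

(** The transpose of M intertwines the original representations in the opposite direction, so
    Schur's lemma applies to it. *)
Lemma dual_hom_mx_rsim n1 n2 (rG1 : mx_representation F H n1)
    (rG2 : mx_representation F H n2) M :
    mx_irreducible rG1 -> mx_irreducible rG2 ->
    hom_mx (dual_repr rG1) (dual_repr rG2) M -> M != 0 -> mx_rsim rG1 rG2.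
Proof.
move=> irr1 irr2 homM nzM; apply: mx_rsim_sym.
apply: (@hom_mx_rsim _ _ _ _ M^T); rewrite ?trmx_eq0 // => h Hh.
have:= homM _ (groupVr Hh); rewrite /= invgK => /(congr1 trmx).
by rewrite !trmx_mul !trmxK.
Qed.

Lemma dual_dual_hom_mx n1 n2 (rG1 : mx_representation F H n1)
    (rG2 : mx_representation F H n2) M :
  hom_mx rG1 rG2 M -> hom_mx (dual_repr (dual_repr rG1)) rG2 M.
Proof. by move=> homM h Hh; rewrite /= trmxK invgK homM. Qed.

(* Averaging a decomposition of the identity along a sum of simple submodules *)
(* yields one into endomorphisms that factor through these submodules.        *)
Lemma hom_mx_simple_factor n (rG : mx_representation F H n) (U : lmodType F)
    (L : {linear 'M[F]_n -> U}) :
    #|H|%:R != 0 :> F -> L 1%:M != 0 ->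
  exists m (rW : mx_representation F H m) (M : 'M_(m, n)) (N : 'M_(n, m)),
    [/\ mx_irreducible rW, hom_mx rW rG M, hom_mx rG rW N & L (N *m M) != 0].
Proof.
move=> nzH nzL; have redG : mx_completely_reducible rG 1%:M.
  by apply: mx_Maschke_pchar; rewrite /pgroup pcharf'_nat.
(* The semisimple decomposition is only provided classically, that is, for boolean goals, so the
   goal is reflected into one. *)
have /(_ (asbool _)) := mx_reducible_semisimple (mxmodule1 rG) redG.
move=> ssG; apply/asboolP; apply: ssG => -[I W /= simW def1 _]; apply/asboolP.
have: (1%:M <= \sum_i W i)%MS by rewrite def1.
case/sub_sumsmxP=> u sum1; pose q i := hom_avg rG rG (u i *m W i).
have sum_q : \sum_i q i = 1%:M.
  transitivity (hom_avg rG rG 1%:M); first by rewrite sum1 linear_sum.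
  by rewrite hom_avg_id // => h _; rewrite mulmx1 mul1mx.
have [i nzLq] : exists i, L (q i) != 0.
  apply/existsP; apply: contraR nzL; rewrite negb_exists => /forallP Lq0.
  rewrite -sum_q linear_sum big1 // => i _; apply/eqP; rewrite -[_ == _]negbK.
  exact: Lq0.
have [modW _ _] := simW i; pose rW := submod_repr modW.
have sqW : (q i <= W i)%MS.
  rewrite scalemx_sub // summx_sub // => h Hh; rewrite -!mulmxA.
  by rewrite mulmx_sub // mulmx_sub // (mxmoduleP modW).
exists _, rW, (val_submod 1%:M), (in_submod (W i) (q i)).
split; first exact/submod_mx_irr.
- by move=> h Hh; rewrite -val_submodE -(val_submodJ modW) // mul1mx.
- move=> h Hh; rewrite -in_submodJ // -(hom_avgP rG rG) //.
  by rewrite in_submodE [in RHS]in_submodE mulmxA.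
- by rewrite -val_submodE in_submodK.
Qed.

End Intertwiners.

(** * Polarization of tensor powers *)

Lemma poly_nat_roots_eq0 (F : fieldType) (p : {poly F}) :
  [pchar F] =i pred0 -> (forall i : nat, p.[i%:R] = 0) -> p = 0.
Proof.
move=> char0 p0; apply/eqP; apply: contraT => nzp.
have inj_nat : injective (fun i : nat => i%:R : F).
  move=> i j /eqP; wlog le_ij: i j / (i <= j)%N => [wl|].
    by case/orP: (leq_total i j) => [/wl//|/wl]; rewrite eq_sym => /[apply].
  rewrite eq_sym -subr_eq0 -natrB // ((pcharf0P _).1 char0) subn_eq0 => le_ji.
  by apply/eqP; rewrite eqn_leq le_ij.
have := @max_poly_roots _ p [seq i%:R | i <- iota 0 (size p)] nzp.
rewrite size_map size_iota ltnn map_inj_uniq // iota_uniq; apply=> //.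
by apply/allP=> _ /mapP[i _ ->]; rewrite /root p0.
Qed.

(** Inclusion-exclusion: the sum factors over j, and the factor at j is 1 minus the indicator that
    the fibre of [phi] over j is empty. The product thus detects surjectivity, which is injectivity
    here. *)
Lemma sum_signed_bool_ffun (R : comPzRingType) n (phi : {ffun 'I_n -> 'I_n}) :
  \sum_(e : {ffun 'I_n -> bool})
     (\prod_j (-1) ^+ ~~ e j) * (\prod_i (e (phi i))%:R)
  = (injectiveb phi)%:R :> R.
Proof.
pose G j (b : bool) : R := (-1) ^+ (~~ b) * \prod_(i | phi i == j) b%:R.
transitivity (\prod_j \sum_(b : bool) G j b).
  rewrite bigA_distr_bigA; apply: eq_bigr => e _; rewrite big_split /=.
  congr (_ * _); rewrite (partition_big phi predT) //=.
  by apply: eq_bigr => j _; apply: eq_bigr => i /eqP->.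
under eq_bigr do rewrite big_bool /G /= expr0 mul1r big1_eq expr1 mulN1r.
case: injectiveP => [inj|ninj].
  rewrite big1 // => j _; have [psi _ psiK] := injF_bij inj.
  by rewrite (bigD1 (psi j)) ?psiK //= mul0r subr0.
have /existsP[j j_notin] : [exists j, j \notin codom phi].
  apply: contra_notT ninj; rewrite negb_exists => /forallP surj.
  apply/injectiveP/card_uniqP; rewrite size_codom; apply: eq_card => j.
  by rewrite !inE -[_ \in _]negbK surj.
rewrite (bigD1 j) //= big_pred0 ?subrr ?mul0r // => i.
by apply: contraNF j_notin => /eqP<-; apply: codom_f.
Qed.

Section TensorOperators.
Variables (F : fieldType) (N n : nat).
Implicit Types C : 'I_n -> 'M[F]_N.

(** Hence pure tensor operators span all operators, and linear claims need only be checked on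
    them. *)
Lemma delta_tensop (a b : 'I_(tdeg N n)) :
  delta_mx a b = tensop (fun i => delta_mx (tfun a i) (tfun b i)) :> 'M[F]__.
Proof.
apply/matrixP => c d; rewrite !mxE; under eq_bigr do rewrite mxE.
case: eqP => [->|neq_ca].
  case: eqP => [->|neq_db]; first by rewrite big1 // => i _; rewrite !eqxx.
  have [i neq_i] : exists i, tfun d i != tfun b i.
    apply/existsP; apply: contra_notT neq_db; rewrite negb_exists => /forallP eq_i.
    by apply: tfun_inj; apply/ffunP => i; apply/eqP; rewrite -[_ == _]negbK.
  by rewrite (bigD1 i) //= (negPf neq_i) andbF mul0r.
have [i neq_i] : exists i, tfun c i != tfun a i.
  apply/existsP; apply: contra_notT neq_ca; rewrite negb_exists => /forallP eq_i.
  by apply: tfun_inj; apply/ffunP => i; apply/eqP; rewrite -[_ == _]negbK.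
by rewrite (bigD1 i) //= (negPf neq_i) mul0r.
Qed.

Lemma sum_tensop (I : finType) (E : 'I_n -> I -> 'M[F]_N) :
  \sum_(g : {ffun 'I_n -> I}) tensop (fun i => E i (g i))
  = tensop (fun i => \sum_x E i x).
Proof.
apply/matrixP => a b; rewrite summxE !mxE.
under [RHS]eq_bigr do rewrite summxE.
by rewrite bigA_distr_bigA; apply: eq_bigr => g _; rewrite mxE.
Qed.

(** Expanding the tensor powers gives a term for each self-map of the index set; the signed sum over
    subsets cancels all terms but those of permutations. *)
Lemma tensop_polarization C :
  \sum_(s : 'S_n) tensop (fun i => C (s i))
  = \sum_(e : {ffun 'I_n -> bool})
      (\prod_j (-1) ^+ ~~ e j) *: tensop (fun=> \sum_j (e j)%:R *: C j).
Proof.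
apply/matrixP => a b; rewrite !summxE.
pose m (phi : {ffun 'I_n -> 'I_n}) := \prod_i C (phi i) (tfun a i) (tfun b i).
transitivity (\sum_phi m phi * (injectiveb phi)%:R).
  rewrite [RHS](bigID (fun phi : {ffun 'I_n -> 'I_n} => injectiveb phi)) /=.
  rewrite [X in _ + X]big1 => [|phi /negPf->]; last by rewrite mulr0.
  rewrite addr0 (reindex (@pval _)) /=; last first.
    pose in_Sn := insubd (1%g : 'S_n).
    by exists in_Sn => /= f Uf; first apply: val_inj; apply: insubdK.
  have injs (s : 'S_n) : injectiveb (pval s).
    by apply/injectiveP => i j; rewrite pvalE; apply: perm_inj.
  rewrite [RHS](eq_bigl predT) //; apply: eq_bigr => s _; rewrite mxE injs mulr1 /m.
  apply: eq_bigr => i _.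
  by rewrite -pvalE.
under eq_bigr do rewrite -sum_signed_bool_ffun mulr_sumr.
rewrite exchange_big; apply: eq_bigr => e _ /=; rewrite !mxE.
under [X in _ = _ * X]eq_bigr do rewrite summxE.
rewrite bigA_distr_bigA mulr_sumr; apply: eq_bigr => phi _.
rewrite mulrCA; congr (_ * _); rewrite mulrC -big_split; apply: eq_bigr => i _.
by rewrite mxE.
Qed.

End TensorOperators.

(** * Schur-Weyl duality for the wreath product *)

Section SchurWeyl.
Variables (F : fieldType) (gT : finGroupType) (N n : nat).
Variable V : mx_representation F [set: gT] N.
Hypothesis char0 : [pchar F] =i pred0.

Let T := wreath_tens n V.

Lemma nat_neq0 m : (0 < m)%N -> m%:R != 0 :> F.
Proof. by rewrite lt0n ((pcharf0P _).1 char0). Qed.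

Lemma aut_rep_shift A t : centgmx V A -> ~~ root (char_poly (- A)) t ->
  A + t%:M \in aut_rep V.
Proof.
move=> /centgmxP cVA nroot; apply/andP; split.
  have -> : A + t%:M = - (- A - t%:M) by rewrite opprB opprK addrC.
  rewrite -row_free_unit /row_free mxrank_opp -/(row_free _) -kermx_eq0.
  by move: nroot; rewrite -eigenvalue_root_char negbK.
apply/centgmxP=> x Gx; rewrite mulmxDl mulmxDr cVA //.
by rewrite scalar_mxC.
Qed.

Section Density.
Variables (p q : nat) (f : {linear 'M[F]_(tdeg N n) -> 'M[F]_(p, q)}).
Hypothesis f_aut : forall A, A \in aut_rep V -> f (tensop (fun=> A)) = 0.

(* For fixed A the entries of f of the tensor power of A + t are polynomials *)
(* in t that vanish whenever A + t is invertible.                            *)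
Lemma aut_rep_dense A : centgmx V A -> f (tensop (fun=> A)) = 0.
Proof.
move=> cVA; apply/matrixP => i j; rewrite mxE.
pose P := \sum_a \sum_b f (delta_mx a b) i j *:
  \prod_k ((A (tfun a k) (tfun b k))%:P + ((tfun a k == tfun b k)%:R *: 'X)).
have PE t : P.[t] = f (tensop (fun=> A + t%:M)) i j.
  rewrite [tensop _]matrix_sum_delta linear_sum summxE /P horner_sum.
  apply: eq_bigr => a _; rewrite linear_sum summxE horner_sum.
  apply: eq_bigr => b _; rewrite linearZ !mxE hornerZ horner_prod mulrC.
  congr (_ * _); apply: eq_bigr => k _.
  by rewrite hornerD hornerC hornerZ hornerX !mxE mulr_natl.
(* The factor [char_poly (- A)] vanishes at the values of t where A + t is singular, so the product
   vanishes at every natural number. *)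
have : P * char_poly (- A) = 0.
  apply: poly_nat_roots_eq0 => // k; rewrite hornerM.
  have [/eqP->|nroot] := boolP (root (char_poly (- A)) k%:R); first by rewrite mulr0.
  by rewrite PE f_aut ?mxE ?mul0r // aut_rep_shift.
move/eqP; rewrite mulf_eq0 (negPf (monic_neq0 (char_poly_monic _))) orbF => /eqP P0.
have:= PE 0; rewrite P0 horner0 => ->; congr (f _ i j); apply: tensop_eq => k.
by rewrite raddf0 addr0.
Qed.

(** The sums of the [C j] produced by polarization are equivariant but possibly singular, which is
    why [aut_rep_dense] is needed. *)
Lemma sym_tensop_eq0 (C : 'I_n -> 'M[F]_N) :
  (forall i, centgmx V (C i)) -> f (\sum_(s : 'S_n) tensop (fun i => C (s i))) = 0.
Proof.
move=> cVC; rewrite tensop_polarization linear_sum big1 // => e _.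
rewrite linearZ /= aut_rep_dense ?scaler0 //; apply/centgmxP=> x Gx.
rewrite mulmx_suml mulmx_sumr; apply: eq_bigr => j _.
by rewrite -scalemxAl -scalemxAr (centgmxP (cVC j)).
Qed.

End Density.

Lemma hom_wreath_tens_permop B s : hom_mx T T B ->
  permop F N s *m B = B *m permop F N s.
Proof.
move=> homB; have uP : (s, 1%g : gpow gT n) \in setX [set: 'S_n] [set: gpow gT n].
  by rewrite !inE.
have := homB (SdPair _ uP : wreath gT n) (in_setT _).
rewrite /= /wreath_tens_mx /= (@tensop_eq _ _ _ _ (fun=> 1%:M)) ?tensop1 ?mulmx1 //.
by move=> i; rewrite ffunE repr_mx1.
Qed.

Lemma hom_wreath_tens_tensop B (g : {ffun 'I_n -> gT}) : hom_mx T T B ->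
  tensop (fun i => V (g i)) *m B = B *m tensop (fun i => V (g i)).
Proof.
move=> homB; have uP : (1%g, g : gpow gT n) \in setX [set: 'S_n] [set: gpow gT n].
  by rewrite !inE.
have := homB (SdPair _ uP : wreath gT n) (in_setT _).
by rewrite /= /wreath_tens_mx /= permop1 !mul1mx.
Qed.

(* Dual form of the statement that the tensor powers of elements of aut_rep V *)
(* span the commutant of the wreath product.                                  *)
Lemma schur_weyl p q (f : {linear 'M[F]_(tdeg N n) -> 'M[F]_(p, q)}) :
  (forall A, A \in aut_rep V -> f (tensop (fun=> A)) = 0) ->
  forall B, hom_mx T T B -> f B = 0.
Proof.
move=> f_aut B homB.
(* [K1] and [K2] are unnormalized averages over G^n and S_n. They multiply B by nonzero integers, so
   it suffices that f kills [K2 (K1 M)] for every M, and by linearity for pure tensor operators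
   M. *)
pose K1 M := \sum_(g : {ffun 'I_n -> gT})
  tensop (fun i => V (g i)^-1%g) *m M *m tensop (fun i => V (g i)).
pose K2 M := \sum_(s : 'S_n) permop F N s^-1%g *m M *m permop F N s.
have K1D : linear K1.
  move=> a M M'; rewrite /K1 scaler_sumr -big_split; apply: eq_bigr => g _ /=.
  by rewrite mulmxDr mulmxDl -scalemxAr -scalemxAl.
have K2D : linear K2.
  move=> a M M'; rewrite /K2 scaler_sumr -big_split; apply: eq_bigr => g _ /=.
  by rewrite mulmxDr mulmxDl -scalemxAr -scalemxAl.
have K1B : K1 B = #|{ffun 'I_n -> gT}|%:R *: B.
  rewrite scaler_nat -sumr_const; apply: eq_bigr => g _.
  rewrite -mulmxA -hom_wreath_tens_tensop // mulmxA tensopM.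
  rewrite (@tensop_eq _ _ _ _ (fun=> 1%:M)) ?tensop1 ?mul1mx // => i.
  by rewrite -repr_mxM ?inE // mulVg repr_mx1.
have K2B : K2 B = #|{: 'S_n}|%:R *: B.
  rewrite scaler_nat -sumr_const; apply: eq_bigr => s _.
  by rewrite -mulmxA -hom_wreath_tens_permop // mulmxA permopM mulVg permop1 mul1mx.
have K_tensop C : f (K2 (K1 (tensop C))) = 0.
  (* Averaging over G^n acts on each tensor factor separately and makes it G-equivariant. *)
  pose D j := \sum_x V x^-1%g *m C j *m V x.
  have -> : K1 (tensop C) = tensop D.
    rewrite -sum_tensop; apply: eq_bigr => g _; rewrite !tensopM.
    exact: tensop_eq.
  have -> : K2 (tensop D) = \sum_(s : 'S_n) tensop (fun i => D (s i)).
    rewrite [RHS](reindex_inj invg_inj); apply: eq_bigr => s _ /=.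
    by rewrite -mulmxA tensop_permop mulmxA permopM mulVg permop1 mul1mx.
  apply: sym_tensop_eq0 => // j; apply/centgmxP => y _.
  rewrite mulmx_suml mulmx_sumr [RHS](reindex_inj (mulIg y)).
  apply: eq_bigr => x _; rewrite !mulmxA invMg !repr_mxM ?inE ?groupV ?inE //.
  by rewrite !mulmxA -repr_mxM ?inE // mulgV repr_mx1 mul1mx.
suff: f (K2 (K1 B)) = 0.
  rewrite K1B.
  pose K2L := HB.pack_for {linear 'M[F]_(tdeg N n) -> 'M[F]_(tdeg N n)} K2
    (GRing.isLinear.Build F _ _ _ K2 K2D).
  rewrite -[K2]/(K2L : _ -> _) linearZ /= K2B !linearZ /= => /eqP.
  rewrite !scaler_eq0 !(negPf (nat_neq0 _)) /=; first by move/eqP.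
    by apply/card_gt0P; exists 1%g.
  by apply/card_gt0P; exists [ffun=> 1%g].
pose K1L := HB.pack_for {linear 'M[F]_(tdeg N n) -> 'M[F]_(tdeg N n)} K1
  (GRing.isLinear.Build F _ _ _ K1 K1D).
pose K2L := HB.pack_for {linear 'M[F]_(tdeg N n) -> 'M[F]_(tdeg N n)} K2
    (GRing.isLinear.Build F _ _ _ K2 K2D).
have -> : f (K2 (K1 B)) = (f \o (K2L \o K1L)) B by [].
rewrite [B]matrix_sum_delta linear_sum big1 // => a _.
rewrite linear_sum big1 // => b _; rewrite linearZ delta_tensop /=.
by rewrite K_tensop scaler0.
Qed.

End SchurWeyl.

(** * Coinvariants as intertwiners from the dual *)

Section CoinvariantsAsHom.
Variables (F : fieldType) (hT : finGroupType) (H : {group hT}).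

Definition tens_mx m n (v : 'rV[F]_(m * n)) : 'M[F]_(m, n) :=
  \matrix_(i, j) v 0 (mxtens_index (i, j)).

Lemma tens_mx_is_linear m n : linear (@tens_mx m n).
Proof. by move=> a u v; apply/matrixP => i j; rewrite !mxE. Qed.
HB.instance Definition _ m n := GRing.isLinear.Build F 'rV[F]_(m * n)
  'M[F]_(m, n) _ (@tens_mx m n) (@tens_mx_is_linear m n).

Lemma tens_mx_inj m n : injective (@tens_mx m n).
Proof.
move=> u v eq_uv; apply/rowP => k; case: (mxtens_indexP k) => i j.
by move/matrixP/(_ i j): eq_uv; rewrite !mxE.
Qed.

Lemma tens_mx_surj m n (M : 'M[F]_(m, n)) : exists v, tens_mx v = M.
Proof.
exists (\row_k M (mxtens_unindex k).1 (mxtens_unindex k).2).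
by apply/matrixP => i j; rewrite !mxE mxtens_indexK.
Qed.

(** The transpose on the left factor is what makes the diagonal action on the tensor product the
    conjugation action on maps from the dual of X. *)
Lemma tens_mx_tensmx m n p q (v : 'rV[F]_(m * n)) (A : 'M[F]_(m, p))
    (B : 'M[F]_(n, q)) :
  tens_mx (v *m (A *t B)) = A^T *m tens_mx v *m B.
Proof.
apply/matrixP => i j; rewrite !mxE; under [RHS]eq_bigr do rewrite mxE mulr_suml.
rewrite exchange_big pair_big (reindex (@mxtens_index m n)) /=; last first.
  by apply: onW_bij; exists (@mxtens_unindex m n);
     [apply: mxtens_indexK | apply: mxtens_unindexK].
apply: eq_bigr => -[k l] _; rewrite tensmxE !mxE.
by rewrite mulrA [v 0 _ * _]mulrC.
Qed.

Variables X E : representation F H.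
Hypothesis nzH : #|H|%:R != 0 :> F.
Let Y := dual_repr X.

Lemma hom_avg_tens_mx v :
  hom_avg Y E (tens_mx v)
  = tens_mx (#|H|%:R^-1 *: \sum_(h in H) v *m (X h *t E h)).
Proof.
rewrite linearZ linear_sum; congr (_ *: _); apply: eq_bigr => h _.
by rewrite /= tens_mx_tensmx invgK.
Qed.

(** If v averages to 0, then v is minus the average of the v h - v, which are relations. Conversely
    v h and v have the same average. *)
Lemma hom_avg_tens_mx_eq0 v :
  (hom_avg Y E (tens_mx v) == 0) = (v <= coinv_rel X E)%MS.
Proof.
apply/eqP/idP => [|/sub_sumsmxP[u ->]].
  rewrite hom_avg_tens_mx -[in RHS](linear0 (@tens_mx _ _)) => /tens_mx_inj avg0.
  have -> : v = - (#|H|%:R^-1 *: \sum_(h in H) v *m (X h *t E h - 1%:M)).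
    under eq_bigr do rewrite mulmxBr mulmx1.
    rewrite sumrB scalerBr avg0 sub0r opprK sumr_const -scaler_nat scalerA.
    by rewrite mulVf ?scale1r.
  rewrite eqmx_opp scalemx_sub // summx_sub // => h Hh.
  by rewrite mulmx_sub // (sumsmx_sup h).
rewrite !linear_sum big1 // => h Hh; rewrite mulmxBr mulmx1 !linearB /=.
apply/eqP; rewrite subr_eq0 !hom_avg_tens_mx; apply/eqP.
rewrite [in RHS](reindex_inj (mulgI h)) /=.
congr (tens_mx (_ *: _)); apply: eq_big => x; first by rewrite groupMl.
move=> Hx; by rewrite !repr_mxM // -tensmx_mul mulmxA.
Qed.

Definition coinv_hom (u : 'rV[F]_(coinv_deg X E)) :=
  hom_avg Y E (tens_mx (val_factmod (u : 'rV_(\rank (cokermx (coinv_rel X E)))))).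

Lemma coinv_hom_is_linear : linear coinv_hom.
Proof. by move=> a u v; rewrite /coinv_hom !linearP. Qed.
HB.instance Definition _ := GRing.isLinear.Build F
  'rV[F]_(coinv_deg X E) 'M[F]_(rdegree X, rdegree E) _ coinv_hom
  coinv_hom_is_linear.

Lemma coinv_homP u : hom_mx Y E (coinv_hom u).
Proof. exact: hom_avgP. Qed.

Lemma coinv_hom_eq0 u : (coinv_hom u == 0) = (u == 0).
Proof.
by rewrite hom_avg_tens_mx_eq0 -in_factmod_eq0 val_factmodK.
Qed.

(** Independence of the representative chosen by [val_factmod]. *)
Lemma coinv_hom_in_factmod v :
  coinv_hom (in_factmod (coinv_rel X E) v) = hom_avg Y E (tens_mx v).
Proof.
apply/eqP; rewrite -subr_eq0 /coinv_hom -!linearB /= hom_avg_tens_mx_eq0.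
rewrite -{2}[v](add_sub_fact_mod (coinv_rel X E)) opprD addrCA subrr addr0.
by rewrite eqmx_opp val_submodP.
Qed.

Lemma coinv_hom_surj M : hom_mx Y E M -> exists u, coinv_hom u = M.
Proof.
move=> homM; have [v vM] := tens_mx_surj M.
by exists (in_factmod _ v); rewrite coinv_hom_in_factmod vM hom_avg_id.
Qed.

Lemma coinv_hom_op u A :
  hom_mx E E A -> coinv_hom (u *m coinv_op X A) = coinv_hom u *m A.
Proof.
move=> homA; have -> : u *m coinv_op X A
    = in_factmod (coinv_rel X E) (val_factmod u *m (1%:M *t A)).
  by rewrite /coinv_op [val_factmod u]val_factmodE in_factmodE [RHS]in_factmodE !mulmxA.
rewrite coinv_hom_in_factmod tens_mx_tensmx trmx1 mul1mx /coinv_hom /hom_avg.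
rewrite -scalemxAl mulmx_suml; congr (_ *: _); apply: eq_bigr => h Hh.
by rewrite -!mulmxA homA.
Qed.

End CoinvariantsAsHom.

(** * Representations of matrix groups and homogeneity *)

Section MatrixGroupReps.
Variables (F : fieldType) (N : nat) (S : pred 'M[F]_N).
Implicit Types W : mgrep S.

Lemma mg_rsim_refl W : mg_rsim W W.
Proof.
exists 1%:M => // [|A _]; first by rewrite row_free_unit unitmx1.
by rewrite mulmx1 mul1mx.
Qed.

Lemma mg_rsim_sym W1 W2 : mg_rsim W1 W2 -> mg_rsim W2 W1.
Proof.
case: W1 W2 => [d1 f1 f11 f1M] [d2 f2 f21 f2M] [/= B eq_d].
rewrite /mgfun /=; move: f1 f11 f1M B; rewrite eq_d => f1 f11 f1M B.
rewrite row_free_unit => injB homB; exists (invmx B) => //= [|A SA].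
  by rewrite row_free_unit unitmx_inv.
by apply: canRL (mulKmx injB) _; rewrite mulmxA -homB ?mulmxK.
Qed.

Lemma mg_rsim_trans W1 W2 W3 : mg_rsim W1 W2 -> mg_rsim W2 W3 -> mg_rsim W1 W3.
Proof.
case=> [B1 eq12 freeB1 homB1] [B2 eq23 freeB2 homB2].
exists (B1 *m B2) => [||A SA]; first by rewrite eq12.
  by rewrite /row_free mxrankMfree.
by rewrite mulmxA homB1 // -!mulmxA homB2.
Qed.

Lemma eq_mg_class W1 W2 : mg_class W1 = mg_class W2 <-> mg_rsim W1 W2.
Proof.
split=> [eqW|simW].
  by suff: mg_class W1 W2 by []; rewrite eqW; apply: mg_rsim_refl.
apply: funext => W; apply: propext; split=> simW3; apply: mg_rsim_trans simW3 => //.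
exact: mg_rsim_sym.
Qed.

Lemma mg_rsim_irreducible W1 W2 (B : 'M_(mgdeg W1, mgdeg W2)) :
    mg_irreducible W1 -> mg_irreducible W2 ->
    (forall A, A \in S -> W1 A *m B = B *m W2 A) -> B != 0 ->
  mg_rsim W1 W2.
Proof.
move=> [_ irr1] [_ irr2] homB nzB.
have freeB : row_free B.
  rewrite -kermx_eq0; apply: contraR nzB => nzK.
  suff /irr1/(_ nzK) : forall A, A \in S -> stablemx (kermx B) (W1 A).
    by rewrite -sub1mx => /sub_kermxP; rewrite mul1mx => ->.
  move=> A SA; apply/sub_kermxP.
  by rewrite -mulmxA homB // mulmxA mulmx_ker mul0mx.
have /eqP fullB : row_full B.
  suff: row_full <<B>>%MS by rewrite -!sub1mx genmxE.
  apply: irr2 => [A SA|]; last by rewrite -mxrank_eq0 genmxE mxrank_eq0.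
  by rewrite (eqmxMr _ (genmxE _)) genmxE -homB // submxMl.
by exists B => //; rewrite -fullB; apply/esym/eqP.
Qed.

Lemma mg_rsim0 W : mg_rsim W (mgrep0 S) <-> mgdeg W = 0.
Proof.
split=> [[]//|W0]; exists 0 => // [|A _]; last by rewrite mul0mx mulmx0.
by rewrite /row_free mxrank0 W0.
Qed.

Section Homogeneous.
Variable n : nat.

(** Listing the n variables of a monomial with repetition assigns one matrix entry to each tensor
    factor. *)
Lemma mnm_prodE (m : 'X_{1..N * N}) : mdeg m = n ->
  exists t : n.-tuple 'I_(N * N),
    forall v : 'I_(N * N) -> F, \prod_k v k ^+ m k = \prod_i v (tnth t i).
Proof.
move=> degm; pose s := flatten [seq nseq (m k) k | k <- enum 'I_(N * N)].
have size_s : size s == n.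
  rewrite size_flatten /shape -map_comp sumnE big_map big_enum -degm mdegE /=.
  by apply/eqP; apply: eq_bigr => k _; rewrite size_nseq.
exists (Tuple size_s) => w; rewrite -(big_tuple _ _ (Tuple size_s) predT w) /=.
rewrite big_flatten big_map big_enum; apply: eq_bigr => k _.
by rewrite big_nseq iter_mulr_1.
Qed.

Lemma homog_polyE (p : {mpoly F[N * N]}) : p \is n.-homog ->
  exists c : 'M[F]_(tdeg N n), forall A : 'M[F]_N,
    p.@[fun k => mxvec A 0 k] = \sum_a \sum_b c a b * tensop (fun=> A) a b.
Proof.
move=> /dhomogP homp.
have cX m : m \in msupp p -> exists c : 'M[F]_(tdeg N n), forall A : 'M[F]_N,
    \prod_k mxvec A 0 k ^+ m k = \sum_a \sum_b c a b * tensop (fun=> A) a b.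
  move=> /homp/mnm_prodE[t tE].
  have /fin_all_exists[r rE] i : exists r : 'I_N * 'I_N,
      tnth t i = mxvec_index r.1 r.2.
    by case: (mxvec_indexP (tnth t i)) => k l; exists (k, l).
  (* The monomial is a single entry of the tensor power: its row and column multi-indices collect
     the rows and columns of the n variables. *)
  pose a0 := tindex [ffun i => (r i).1]; pose b0 := tindex [ffun i => (r i).2].
  exists (delta_mx a0 b0) => A; rewrite tE (bigD1 a0) //= (bigD1 b0) //=.
  rewrite [X in _ = _ + X]big1 => [|a /negPf ne_a]; last first.
    by rewrite big1 // => b _; rewrite mxE ne_a mul0r.
  rewrite [X in _ = _ + X + _]big1 => [|b /negPf ne_b]; last first.
    by rewrite mxE ne_b andbF mul0r.
  rewrite !mxE !eqxx mul1r !addr0; apply: eq_bigr => i _.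
  by rewrite rE mxvecE !tindexK !ffunE.
suff sumX s : {subset s <= msupp p} ->
    exists c : 'M[F]_(tdeg N n), forall A : 'M[F]_N,
      \sum_(m <- s) p@_m * \prod_k mxvec A 0 k ^+ m k
      = \sum_a \sum_b c a b * tensop (fun=> A) a b.
  by have [c cE] := sumX _ (fun=> id); exists c => A; rewrite mevalE.
elim: s => [_|m s IHs sub_s].
  exists 0 => A; rewrite big_nil big1 // => a _.
  by rewrite big1 // => b _; rewrite mxE mul0r.
have [c cE] := cX m (sub_s m (mem_head m s)).
have [m' s_m'|c' c'E] := IHs.
  by rewrite sub_s // inE s_m' orbT.
exists (p@_m *: c + c') => A; rewrite big_cons cE c'E mulr_sumr -big_split.
apply: eq_bigr => a _; rewrite /= mulr_sumr -big_split; apply: eq_bigr => b _ /=.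
by rewrite !mxE mulrDl mulrA.
Qed.

(** The entries of the n-th tensor power of A are degree n monomials in the entries of A, and every
    such monomial occurs among them. *)
Lemma mg_homog_polyP (W : mgrep S) :
  mg_homog_poly n W <->
  exists L : {linear 'M[F]_(tdeg N n) -> 'M[F]_(mgdeg W)},
    forall A, A \in S -> W A = L (tensop (fun=> A)).
Proof.
split=> [homW|[L WL] i j].
  have cP i j : exists c : 'M[F]_(tdeg N n), forall A, A \in S ->
      W A i j = \sum_a \sum_b c a b * tensop (fun=> A) a b.
    have [p homp pE] := homW i j; have [c cE] := homog_polyE homp.
    by exists c => A SA; rewrite pE.
  have /fin_all_exists[c {}cP] i := fin_all_exists (cP i).
  pose L (M : 'M[F]_(tdeg N n)) : 'M[F]_(mgdeg W) :=
    \matrix_(i, j) \sum_a \sum_b c i j a b * M a b.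
  have linL : linear L.
    move=> a M M'; apply/matrixP => i j; rewrite !mxE mulr_sumr -big_split.
    apply: eq_bigr => k _ /=; rewrite mulr_sumr -big_split; apply: eq_bigr => l _.
    by rewrite !mxE mulrDr mulrCA.
  exists (HB.pack_for {linear 'M[F]_(tdeg N n) -> 'M[F]_(mgdeg W)} L
    (GRing.isLinear.Build F _ _ _ L linL)) => A SA.
  by apply/matrixP => i j; rewrite mxE cP.
exists (\sum_a \sum_b L (delta_mx a b) i j *:
  \prod_k 'X_(mxvec_index (tfun a k) (tfun b k))) => [|A SA].
  apply: rpred_sum => a _; apply: rpred_sum => b _; apply: rpredZ.
  rewrite mprodXE dhomogX /= mdeg_sum; under eq_bigr do rewrite mdeg1.
  by rewrite sum_nat_const card_ord muln1.
rewrite WL // [tensop _]matrix_sum_delta !raddf_sum summxE; apply: eq_bigr => a _.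
rewrite !raddf_sum summxE; apply: eq_bigr => b _.
rewrite /= mevalZ linearZ mxE mulrC; congr (_ * _).
rewrite rmorph_prod /= mxE; apply: eq_bigr => k _.
by rewrite mevalXU mxvecE.
Qed.

End Homogeneous.
End MatrixGroupReps.

(** * Phi on irreducible representations: well-definedness, injectivity, surjectivity *)

Section PhiFunctor.
Variables (F : fieldType) (gT : finGroupType) (N n : nat).
Variable V : mx_representation F [set: gT] N.
Hypothesis char0 : [pchar F] =i pred0.

Local Notation H := [set: wreath gT n]%G.
Local Notation T := (wreath_tens n V).
Implicit Types X : representation F H.

Lemma card_wreath_neq0 : #|H|%:R != 0 :> F.
Proof. exact/nat_neq0/cardG_gt0. Qed.

Lemma tensop_hom_mx A : A \in aut_rep V -> hom_mx T T (tensop (fun=> A)).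
Proof. by move=> autA u _; apply: wreath_tens_aut. Qed.

Lemma scalar1_aut_rep : 1%:M \in aut_rep V.
Proof. by rewrite !inE unitmx1; apply/centgmxP => x _; rewrite mulmx1 mul1mx. Qed.

Lemma coinv_op_is_linear X : linear (coinv_op X (E' := T)).
Proof.
move=> a A B; rewrite /coinv_op.
have -> : 1%:M *t (a *: A + B) = a *: (1%:M *t A) + 1%:M *t B
    :> 'M[F]_(rdegree X * rdegree T).
  by apply/matrixP => i j; rewrite !mxE mulrDr mulrCA.
by rewrite mulmxDr -scalemxAr linearP.
Qed.
HB.instance Definition _ X := GRing.isLinear.Build F _ _ _ (coinv_op X (E' := T))
  (coinv_op_is_linear X).

Lemma phi_homog_poly X : mg_homog_poly n (phi V X).
Proof. by apply/mg_homog_polyP; exists (coinv_op X (E' := T)). Qed.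

(** Functoriality in X: on intertwiners, the induced map is precomposition with the transpose of
    B. *)
Lemma coinv_hom_functor X X' (B : 'M_(rdegree X, rdegree X')) :
    (forall h, h \in H -> X h *m B = B *m X' h) ->
  exists P : 'M_(coinv_deg X T, coinv_deg X' T),
    forall u, coinv_hom (u *m P) = B^T *m coinv_hom u.
Proof.
move=> homB; exists (in_factmod (coinv_rel X' T) (val_factmod 1%:M *m (B *t 1%:M))).
move=> u; have -> : u *m in_factmod (coinv_rel X' T) (val_factmod 1%:M *m (B *t 1%:M))
    = in_factmod (coinv_rel X' T) (val_factmod u *m (B *t 1%:M)).
  by rewrite [val_factmod u]val_factmodE in_factmodE [RHS]in_factmodE !mulmxA.
rewrite coinv_hom_in_factmod ?card_wreath_neq0 // tens_mx_tensmx mulmx1.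
rewrite /coinv_hom /hom_avg -scalemxAr mulmx_sumr; congr (_ *: _).
apply: eq_bigr => h Hh; rewrite !mulmxA; congr (_ *m _ *m _).
by rewrite /= invgK -!trmx_mul homB.
Qed.

Lemma phi_rsim X X' : mx_rsim X X' -> mg_rsim (phi V X) (phi V X').
Proof.
have nzH := card_wreath_neq0.
have inj X1 X2 (B : 'M_(rdegree X1, rdegree X2))
    (P : 'M_(coinv_deg X1 T, coinv_deg X2 T)) : row_free B ->
    (forall u, coinv_hom (u *m P) = B^T *m coinv_hom u) -> row_free P.
  move=> /mulmxVp; move: (pinvmx B) => B' BB' hP.
  rewrite -kermx_eq0; apply/rowV0P => u /sub_kermxP uP; apply/eqP.
  rewrite -(coinv_hom_eq0 nzH) -[coinv_hom u]mul1mx -trmx1 -BB' trmx_mul.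
  by rewrite -mulmxA -hP uP linear0 mulmx0.
move=> simX; have [B' _ freeB' homB'] := mx_rsim_sym simX.
have [P' hP'] := coinv_hom_functor homB'; have freeP' := inj _ _ _ _ freeB' hP'.
case: simX => B _ freeB homB.
have [P hP] := coinv_hom_functor homB; have freeP := inj _ _ _ _ freeB hP.
exists P => //= [|A autA].
  (* Injections in both directions force equal dimensions. *)
  apply/eqP; rewrite eqn_leq -{1}(eqP freeP) rank_leq_col.
  by rewrite -[X in (X <= _)%N](eqP freeP') rank_leq_col.
have homA := tensop_hom_mx autA.
apply/row_matrixP => k; rewrite !rowE mulmxA [RHS]mulmxA; apply/eqP.
rewrite -subr_eq0 -(coinv_hom_eq0 nzH) linearB subr_eq0 /= hP.
by rewrite !coinv_hom_op // hP mulmxA.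
Qed.

Lemma phi_intertwiner X X' (B : 'M_(mgdeg (phi V X), mgdeg (phi V X'))) :
    (forall A, A \in aut_rep V -> phi V X A *m B = B *m phi V X' A) ->
  forall A, hom_mx T T A -> coinv_op X A *m B = B *m coinv_op X' A.
Proof.
move=> homB A homA; apply/eqP; rewrite -subr_eq0; apply/eqP.
pose f : {linear 'M[F]_(tdeg N n) -> 'M_(_, _)} :=
  (mulmxr B \o coinv_op X (E' := T)) \- (mulmx B \o coinv_op X' (E' := T)).
apply: (schur_weyl char0 (f := f) _ homA) => {homA}A autA.
by rewrite /= -[coinv_op X _]/(phi V X A) homB // subrr.
Qed.

Lemma phi_stable X m (U : 'M_(m, mgdeg (phi V X))) :
    (forall A, A \in aut_rep V -> stablemx U (phi V X A)) ->
  forall A, hom_mx T T A -> (U *m coinv_op X A <= U)%MS.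
Proof.
move=> stU A homA.
pose f : {linear 'M[F]_(tdeg N n) -> 'M_(_, _)} :=
  mulmxr (cokermx U) \o (mulmx U \o coinv_op X (E' := T)).
rewrite submxE; apply/eqP; apply: (schur_weyl char0 (f := f) _ homA) => {homA}A autA.
by apply/eqP; rewrite /= -submxE; apply: stU.
Qed.

(** Transitivity: if R retracts the intertwiner of a nonzero u, then R followed by the intertwiner
    of v is an endomorphism of T taking u to v. *)
Lemma phi_irreducible X : mx_irreducible X -> (0 < mgdeg (phi V X))%N ->
  mg_irreducible (phi V X).
Proof.
move=> irrX deg_gt0; split=> // U stU nzU.
have nzH := card_wreath_neq0; have irrY := dual_irreducible irrX.
have [u Uu nzu] : exists2 u : 'rV_(mgdeg (phi V X)), (u <= U)%MS & u != 0.
  by exists (nz_row U); rewrite ?nz_row_sub ?nz_row_eq0.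
rewrite -sub1mx; apply/rV_subP => v _.
have nzM : coinv_hom u != 0 by rewrite coinv_hom_eq0.
have [R homR MR] := hom_mx_retract nzH irrY (coinv_homP u) nzM.
have homA := hom_mxM homR (coinv_homP v).
suff <- : u *m coinv_op X (R *m coinv_hom v) = v.
  exact: submx_trans (submxMr _ Uu) (phi_stable stU homA).
apply/eqP; rewrite -subr_eq0 -(coinv_hom_eq0 nzH) linearB subr_eq0 /=.
by rewrite coinv_hom_op // mulmxA MR mul1mx.
Qed.

(* With M R = 1 the endomorphism R M fixes a nonzero vector of phi V X, hence *)
(* also one of phi V X', so that R followed by some homomorphism is nonzero.  *)
Lemma phi_rsim_inj X X' : mx_irreducible X -> mx_irreducible X' ->
    (0 < mgdeg (phi V X))%N -> mg_rsim (phi V X) (phi V X') ->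
  mx_rsim X X'.
Proof.
move=> irrX irrX' deg_gt0 [B _ freeB /phi_intertwiner homB].
have nzH := card_wreath_neq0.
pose u : 'rV[F]_(mgdeg (phi V X)) := delta_mx 0 (Ordinal deg_gt0).
have nzu : u != 0.
  apply/eqP => /rowP/(_ (Ordinal deg_gt0)); rewrite !mxE !eqxx.
  by move/eqP; rewrite oner_eq0.
have nzM : coinv_hom u != 0 by rewrite coinv_hom_eq0.
have [R homR MR] := hom_mx_retract nzH (dual_irreducible irrX) (coinv_homP u) nzM.
pose p := R *m coinv_hom u; have homp : hom_mx T T p by apply: hom_mxM (coinv_homP u).
have up : u *m coinv_op X p = u.
  apply/eqP; rewrite -subr_eq0 -(coinv_hom_eq0 nzH) linearB subr_eq0 /=.
  by rewrite coinv_hom_op // mulmxA MR mul1mx.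
have u'p : u *m B *m coinv_op X' p = u *m B.
  by rewrite -mulmxA -homB // mulmxA up.
have nzu' : u *m B != 0 by rewrite -(inj_eq (row_free_inj freeB)) mul0mx in nzu *.
apply: mx_rsim_sym; apply: (dual_hom_mx_rsim (M := coinv_hom (u *m B) *m R)) => //.
  exact: hom_mxM (coinv_homP _) homR.
apply: contra_neq nzu' => M'R0; apply/eqP; rewrite -(coinv_hom_eq0 nzH) -u'p.
by rewrite coinv_hom_op // mulmxA M'R0 mul0mx.
Qed.

(** The linear extension L of W is multiplicative on End_H(T) and L 1 is nonzero, so L does not kill
    some R M factoring through a simple [rW]. Sending u to a row of L(R u), with u seen as an
    intertwiner, is then a nonzero map from Phi of the dual of [rW] to W, and Schur's lemma
    applies. *)
Lemma phi_surj (W : mgrep (aut_rep V)) :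
    mg_irreducible W -> mg_homog_poly n W ->
  exists2 X : representation F H, mx_irreducible X & mg_rsim (phi V X) W.
Proof.
move=> irrW /mg_homog_polyP[L WL]; have nzH := card_wreath_neq0.
(* Multiplicativity is extended one argument at a time: first B, with A in the group, then A. *)
have LMl A B : A \in aut_rep V -> hom_mx T T B ->
    L (tensop (fun=> A) *m B) = L (tensop (fun=> A)) *m L B.
  move=> autA homB; apply/eqP; rewrite -subr_eq0; apply/eqP.
  pose f : {linear 'M[F]_(tdeg N n) -> 'M_(_, _)} :=
    (L \o mulmx (tensop (fun=> A))) \- (mulmx (L (tensop (fun=> A))) \o L).
  apply: (schur_weyl char0 (f := f) _ homB) => {homB}B autB /=.
  rewrite -!WL // -mgfunM // tensopM WL ?subrr // inE.
  case/andP: autA autB => uA /centgmxP cA /andP[uB /centgmxP cB].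
  rewrite unitmx_mul uA uB; apply/centgmxP => x Gx.
  by rewrite -mulmxA cB // !mulmxA cA.
have LM A B : hom_mx T T A -> hom_mx T T B -> L (A *m B) = L A *m L B.
  move=> homA homB; apply/eqP; rewrite -subr_eq0; apply/eqP.
  pose f : {linear 'M[F]_(tdeg N n) -> 'M_(_, _)} :=
    (L \o mulmxr B) \- (mulmxr (L B) \o L).
  apply: (schur_weyl char0 (f := f) _ homA) => {homA}A autA /=.
  by rewrite LMl // subrr.
have L1 : L 1%:M = 1%:M by rewrite -(mgfun1 W) WL ?scalar1_aut_rep // tensop1.
have nzL1 : L 1%:M != 0 by rewrite L1 -mxrank_eq0 mxrank1 -lt0n irrW.1.
have [m [rW [M [R [irrY homM homR nzLRM]]]]] := hom_mx_simple_factor T nzH nzL1.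
pose X : representation F H := Representation (dual_repr rW).
exists X; first exact: dual_irreducible.
have [i nzi] : exists i, row i (L (R *m M)) != 0.
  apply/existsP; apply: contraR nzLRM; rewrite negb_exists => /forallP rows0.
  by apply/eqP/row_matrixP => i; rewrite row0; apply/eqP/negPn/rows0.
have homRu u : hom_mx T T (R *m coinv_hom (u : 'rV_(coinv_deg X T))).
  apply: hom_mxM homR _ => h Hh.
  by rewrite -(coinv_homP u Hh) /= trmxK invgK.
pose g : {linear 'rV_(mgdeg (phi V X)) -> 'rV_(mgdeg W)} :=
  row i \o (L \o (mulmx R \o (@coinv_hom _ _ _ X T))).
(* M itself is the intertwiner of some u, and g takes this u to the nonzero row i of L(R M). *)
have [u uM] := @coinv_hom_surj _ _ _ X T nzH _ (dual_dual_hom_mx homM).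
have nzg : lin1_mx g != 0.
  apply: contra_neq nzi => g0; have := mul_rV_lin1 g u.
  by rewrite g0 mulmx0 /= uM => <-.
apply: (mg_rsim_irreducible (B := lin1_mx g)) => //.
  apply: phi_irreducible; first exact: dual_irreducible.
  rewrite lt0n; apply: contraNneq nzg => deg0.
  by apply/eqP/matrixP => -[k k_lt]; exfalso; rewrite deg0 in k_lt.
move=> A autA; apply/row_matrixP => k; rewrite !rowE mulmxA [RHS]mulmxA !mul_rV_lin1 /=.
have homA := tensop_hom_mx autA.
by rewrite /phi_fun coinv_hom_op // mulmxA LM // row_mul WL.
Qed.

(** * Nonvanishing of Phi from a free orbit *)

Lemma tensv_col (v : 'I_n -> 'rV[F]_N) (w : 'I_n -> 'cV[F]_N) :
  tensv v *m (\col_a \prod_i w i (tfun a i) 0) = (\prod_i (v i *m w i) 0 0)%:M.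
Proof.
apply/matrixP => i j; rewrite !ord1 !mxE mulr1n.
under [RHS]eq_bigr do rewrite mxE.
rewrite bigA_distr_bigA /= -sum_tdeg; apply: eq_bigr => a _.
by rewrite !mxE -big_split.
Qed.

(* Evaluated on the wreath product orbit of the tensor product of the v i, the *)
(* tensor product of the w i is the indicator function of the identity.        *)
Lemma phi_neq0 X (v : 'I_n -> 'rV[F]_N) (w : 'I_n -> 'cV[F]_N) :
    (forall i j g, v i *m V g *m w j = ((i == j) && (g == 1%g))%:R%:M) ->
    mx_irreducible X -> (0 < mgdeg (phi V X))%N.
Proof.
move=> vVw irrX; have nzH := card_wreath_neq0.
pose wT : 'cV[F]_(rdegree T) := \col_a \prod_i w i (tfun a i) 0.
have orbit_dual u : tensv v *m T u *m wT = (u == 1%g)%:R%:M.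
  rewrite /= /wreath_tens_mx mulmxA tensv_permop tensv_tensop tensv_col.
  congr _%:M; under eq_bigr do rewrite /= vVw mxE mulr1n.
  have [-> | neq_u1] := eqVneq u 1%g.
    by rewrite big1 // => i _; rewrite /= invg1 perm1 ffunE !eqxx.
  have [i neq_i] : exists i, ~~ ((u.1^-1%g i == i) && (u.2 i == 1%g)).
    apply/existsP; apply: contra_neqT neq_u1; rewrite negb_exists => /forallP eq1.
    apply: val_inj; rewrite [val u]surjective_pairing; congr (_, _).
      apply/permP => i; rewrite perm1; have /negPn/andP[/eqP eq_i _] := eq1 i.
      by rewrite -{1}eq_i permKV.
    by apply/ffunP => i; have /negPn/andP[_ /eqP->] := eq1 i; rewrite ffunE.
  by rewrite (bigD1 i) //= (negPf neq_i) mul0r.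
have /mx_irrP[dX_gt0 _] := irrX.
pose c : 'cV[F]_(rdegree X) := delta_mx (Ordinal dX_gt0) 0.
(* Average a rank one map onto the line of the free-orbit vector; applying [wT] leaves only the
   identity term, so M is nonzero. *)
pose M := hom_avg (dual_repr X) T (c *m tensv v).
have assoc (A : 'M_(rdegree X)) (B : 'M_(rdegree T)) :
    A *m (c *m tensv v) *m B *m wT = A *m (c *m (tensv v *m B *m wT)).
  by rewrite -!mulmxA.
have MwT : M *m wT = #|H|%:R^-1 *: c.
  rewrite /M /hom_avg -scalemxAl mulmx_suml; congr (_ *: _).
  rewrite (bigD1 1%g) ?inE // big1 => [|h /andP[_ /negPf neq_h]].
    by rewrite assoc orbit_dual eqxx [LHS]addr0 invg1 repr_mx1 mul1mx mulmx1.
  by rewrite assoc orbit_dual neq_h raddf0 !mulmx0.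
have [u uM] := coinv_hom_surj nzH (hom_avgP (dual_repr X) T (c *m tensv v)).
rewrite lt0n; apply: contraTneq isT => deg0.
have u0 : u = 0.
  apply/rowP => k; have : (k < mgdeg (phi V X))%N by apply: ltn_ord.
  by rewrite [in X in X -> _]deg0.
move: MwT; rewrite /M -uM u0 linear0 mul0mx => /esym/eqP.
rewrite scaler_eq0 invr_eq0 (negPf nzH) /= => /eqP/matrixP/(_ (Ordinal dX_gt0) 0).
by rewrite !mxE !eqxx => /eqP; rewrite oner_eq0.
Qed.

End PhiFunctor.

(* Over a free module the hypothesis of phi_neq0 is met by the identity       *)
(* vectors of the copies of the group algebra and their coordinate functions. *)
Lemma muln_regular_dual (F : fieldType) (gT : finGroupType) d :
  let R := muln_grepr (Representation (regular_repr F [set: gT]%G)) d in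
  exists (v : 'I_d -> 'rV_(rdegree R)) (w : 'I_d -> 'cV_(rdegree R)),
    forall i j g, v i *m R g *m w j = ((i == j) && (g == 1%g))%:R%:M.
Proof.
rewrite /muln_grepr; elim: d => [|d [v [w vRw]]] /=.
  by exists (fun=> 0), (fun=> 0) => -[].
rewrite big_ord_recl; set R := \big[_/_]_(i < d) _ in v w vRw *.
set G := [set: gT]%G; pose k0 := gring_index G 1%g.
pose v0 : 'rV[F]_#|G| := delta_mx 0 k0; pose w0 : 'cV[F]_#|G| := delta_mx k0 0.
pose vv (i : 'I_d.+1) : 'rV_(#|G| + rdegree R) :=
  if unlift ord0 i is Some j then row_mx 0 (v j) else row_mx v0 0.
pose ww (i : 'I_d.+1) : 'cV_(#|G| + rdegree R) :=
  if unlift ord0 i is Some j then col_mx 0 (w j) else col_mx w0 0.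
exists vv, ww => i j g /=; rewrite /vv /ww.
case: unliftP => [i'|] ->; case: unliftP => [j'|] ->;
  rewrite mul_row_block mul_row_col !(mul0mx, mulmx0, addr0, add0r).
- by rewrite vRw (inj_eq lift_inj).
- by rewrite raddf0.
- by rewrite raddf0.
rewrite /v0 /w0 -rowE rowK -colE; apply/matrixP => a b; rewrite !ord1 !mxE.
rewrite gring_indexK ?inE // mul1g eq_sym mulr1n.
by rewrite -(inj_in_eq (can_in_inj (@gring_indexK _ G))) ?inE.
Qed.

Lemma free_dual_basis (F : fieldType) (gT : finGroupType) (d N : nat)
    (V : mx_representation F [set: gT]%G N) :
    mx_rsim V (muln_grepr (Representation (regular_repr F [set: gT]%G)) d) ->
  exists (v : 'I_d -> 'rV_N) (w : 'I_d -> 'cV_N),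
    forall i j g, v i *m V g *m w j = ((i == j) && (g == 1%g))%:R%:M.
Proof.
case/mx_rsim_def=> B [B' B'B VE]; have [v [w vRw]] := muln_regular_dual F gT d.
exists (fun i => v i *m B'), (fun j => B *m w j) => i j g.
rewrite VE ?inE // -vRw !mulmxA -(mulmxA (v i)) B'B mulmx1.
by rewrite -(mulmxA _ B') B'B mulmx1.
Qed.

(* The map on isomorphism classes *)
From mathcomp Require Import complex classical_sets functions reals.

Lemma eq_iso_class (F : fieldType) (hT : finGroupType) (H : {group hT})
    (X X' : representation F H) : mx_rsim X X' -> iso_class X = iso_class X'.
Proof.
move=> simX; apply/seteqP; split=> Z /=; apply: mx_rsim_trans => //.
exact: mx_rsim_sym.
Qed.

Local Open Scope classical_set_scope.

Theorem theorem1p4p3 (R : realType) (gT : finGroupType)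
    (abelG : abelian [set: gT]%G) (d N n : nat)
    (V : mx_representation R[i] [set: gT]%G N)
    (freeV : mx_rsim V
       (muln_grepr (Representation (regular_repr R[i] [set: gT]%G)) d)) :
  let irr := irr_classes R[i] [set: wreath gT n]%G in
  let irr0 := iso_class (@grepr0 R[i] (wreath gT n) [set: wreath gT n]%G) in
  let pol := mg_irr_homog_classes (aut_rep V) n in
  let pol0 := mg_class (mgrep0 (aut_rep V)) in
  exists Phi : set (representation R[i] [set: wreath gT n]%G) ->
               set (mgrep (aut_rep V)),
    [/\ (forall X : representation R[i] [set: wreath gT n]%G,
           mx_irreducible X -> Phi (iso_class X) = mg_class (phi V X)),
        Phi irr0 = pol0
      & [/\ set_fun (irr `|` [set irr0]) (pol `|` [set pol0]) Phi,
            set_surj (irr `|` [set irr0]) (pol `|` [set pol0]) Phi,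
            set_inj [set c | irr c /\ Phi c <> pol0] Phi
          & (n <= d)%N ->
            set_bij (irr `|` [set irr0]) (pol `|` [set pol0]) Phi]].

Proof.
move=> irr irr0 pol pol0.
have char0 : [pchar R[i]] =i pred0 by apply: pchar_num.
(* Taking the union over all members of the class avoids choosing a representative; [phi_rsim] shows
   that it is a single class. *)
pose Phi (c : set (representation R[i] [set: wreath gT n]%G)) :
  set (mgrep (aut_rep V)) := [set W | exists2 X, c X & mg_rsim (phi V X) W].
have PhiE X : Phi (iso_class X) = mg_class (phi V X).
  apply/seteqP; split=> W /= => [[X' /phi_rsim-/(_ _ V) simX simW]|simW].
    by apply: mg_rsim_trans simW; apply: simX.
  by exists X => //; apply: mx_rsim_refl.
have Phi0 : Phi irr0 = pol0.
  rewrite /irr0 PhiE; apply/eq_mg_class/mg_rsim0 => /=; apply/eqP.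
  by rewrite -leqn0 /coinv_deg rank_leq_row.
have Phi_fun : set_fun (irr `|` [set irr0]) (pol `|` [set pol0]) Phi.
  move=> _ [[X irrX <-]|->]; last by right; rewrite /= Phi0.
  rewrite PhiE; have [deg0|deg_gt0] := posnP (mgdeg (phi V X)).
    by right; apply/eq_mg_class/mg_rsim0.
  left; exists (phi V X) => //; split; last exact: phi_homog_poly.
  exact: phi_irreducible.
have Phi_surj : set_surj (irr `|` [set irr0]) (pol `|` [set pol0]) Phi.
  move=> _ [[W [irrW homW] <-]|->]; last by exists irr0 => //; right.
  have [X irrX simW] := phi_surj char0 irrW homW.
  exists (iso_class X); first by left; exists X.
  by rewrite PhiE; apply/eq_mg_class.
have deg_gt0 X : Phi (iso_class X) <> pol0 -> (0 < mgdeg (phi V X))%N.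
  rewrite PhiE lt0n => nz; apply/eqP => deg0; apply: nz.
  exact/eq_mg_class/mg_rsim0.
have Phi_inj : set_inj [set c | irr c /\ Phi c <> pol0] Phi.
  move=> c c' /set_mem[[X irrX <-] nzX] /set_mem[[X' irrX' <-] nzX'].
  rewrite !PhiE => /eq_mg_class simX; apply: eq_iso_class.
  exact: phi_rsim_inj (deg_gt0 _ nzX) simX.
exists Phi; split=> //; split=> // le_nd; split=> //.
(* For n <= d no irreducible class goes to zero, so injectivity extends over the added zero class;
   the first n of the d free summands supply the dual families. *)
have nz c : irr c -> Phi c <> pol0.
  move=> [X irrX <-]; rewrite PhiE => /eq_mg_class/mg_rsim0/eqP.
  have [v [w vVw]] := free_dual_basis freeV; apply/negP; rewrite -lt0n.
  pose wd := widen_ord le_nd.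
  apply: (@phi_neq0 _ _ _ _ _ char0 X (v \o wd) (w \o wd)) => //.
  by move=> i j g /=; rewrite vVw.
move=> c c' /set_mem[irrc|->] /set_mem[irrc'|->] //.
- by apply: Phi_inj; apply/mem_set; split=> //; apply: nz.
- by rewrite Phi0 => /(nz _ irrc).
- by rewrite Phi0 => /esym/(nz _ irrc').
Qed.
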